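(* Assume that for every $i=1,\dots,I$ there exists $\gamma_i>0$ such that $$\|F_i(U_1,U_2)-F_i(U_1^*,U_2^* )\|_{\mathcal H}\le \gamma_i\big(\|U_1-U_1^*\|_{\mathcal H}+\|U_2-U_2^*\|_{\mathcal H}\big)\qquad \forall\,(U_1,U_2),(U_1^*,U_2^* )\in\mathcal H\times\mathcal H .$$ Then for any initial datum $U_0\in C([0,\tau];\mathcal H)$ there exists a unique (mild) solution $U\in C([0,+\infty),\mathcal H)$ of the problem $$U_t(t)=\mathcal A U(t)+\sum_{i=1}^I F_i(U(t),U(t-\tau_i))\ \text{ in }(0,+\infty),\qquad U(t-\tau)=U_0(t)\ \ \forall t\in(0,\tau].$$ Moreover, with $U^0:=U_0(\tau)$, for all $t\ge 0$, $$U(t)=S(t)U^0+\int_0^t S(t-s)\sum_{i=1}^I F_i(U(s),U(s-\tau_i))\,ds .$$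
   Context: $\mathcal H$ is a Hilbert space with norm $\|\cdot\|_{\mathcal H}$. $\mathcal A$ is an operator in $\mathcal H$ generating a $C_0$-semigroup $(S(t))_{t\ge0}$ that is exponentially stable: there are constants $M,\omega>0$ with $\|S(t)\|_{\mathcal L(\mathcal H)}\le Me^{-\omega t}$ for all $t\ge0$. $I$ is a positive integer, $\tau_1,\dots,\tau_I>0$ are pairwise distinct time delays, with $\tau_i<\tau:=\tau_1$ for $i=2,\dots,I$, and $F_i:\mathcal H\times\mathcal H\to\mathcal H$. The initial condition means that $U(s)=U_0(s+\tau)$ for $s\in(-\tau,0]$; these values are used for the delayed terms $U(t-\tau_i)$ when $t\le\tau_i$. A mild solution is a continuous function satisfying the variation of parameters (Duhamel) formula. *)

(* Defs.v *)
From Stdlib Require Import Reals.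
From Coquelicot Require Import Coquelicot.
Open Scope R_scope.

(* Scalars are real: a complex Hilbert space is covered through its underlying
   real Hilbert space, whose inner product is the real part of the original
   one; the norm is the same. *)
Record HilbertSpace := {
  hilbert_space :> CompleteNormedModule R_AbsRing ;
  inner : hilbert_space -> hilbert_space -> R ;
  inner_sym : forall x y, inner x y = inner y x ;
  inner_plus_l : forall x y z, inner (plus x y) z = inner x z + inner y z ;
  inner_scal_l : forall (a : R) x y, inner (scal a x) y = a * inner x y ;
  norm_inner : forall x, norm x ^ 2 = inner x x
}.

(* A possibly unbounded operator; [op] has no meaning outside [dom]. *)
Record LinearOperator (H : HilbertSpace) := {
  dom : H -> Prop ;
  op : H -> H ;
  dom_zero : dom zero ;
  dom_plus : forall x y, dom x -> dom y -> dom (plus x y) ;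
  dom_scal : forall (a : R) x, dom x -> dom (scal a x) ;
  op_plus : forall x y, dom x -> dom y -> op (plus x y) = plus (op x) (op y) ;
  op_scal : forall (a : R) x, dom x -> op (scal a x) = scal a (op x)
}.
Arguments dom {H} _ _.
Arguments op {H} _ _.

Definition operator_norm {H : HilbertSpace} (L : H -> H) : Rbar :=
  Lub_Rbar (fun r => exists x : H, norm x <= 1 /\ r = norm (L x)).

(* Coquelicot's [is_linear] includes boundedness. *)
Record C0_semigroup {H : HilbertSpace} (S : R -> H -> H) : Prop := {
  semigroup_linear : forall t, 0 <= t -> is_linear (S t) ;
  semigroup_0 : forall x, S 0 x = x ;
  semigroup_plus : forall s t x, 0 <= s -> 0 <= t -> S (s + t) x = S s (S t x) ;
  semigroup_continuous :
    forall x, filterlim (fun t => S t x) (at_right 0) (locally x)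
}.

Definition is_generator_value {H : HilbertSpace} (S : R -> H -> H) (x y : H) :=
  filterlim (fun h : R => scal (/ h) (minus (S h x) x)) (at_right 0) (locally y).

Definition generates {H : HilbertSpace} (A : LinearOperator H)
    (S : R -> H -> H) : Prop :=
  (forall x, dom A x <-> exists y, is_generator_value S x y) /\
  (forall x, dom A x -> is_generator_value S x (op A x)).

Definition exponentially_stable {H : HilbertSpace} (S : R -> H -> H) : Prop :=
  exists M omega : R, 0 < M /\ 0 < omega /\
    forall t, 0 <= t -> Rbar_le (operator_norm (S t)) (M * exp (- omega * t)).

(* [RInt] is a total operator, so integrability is required alongside the
   formula. *)
Definition duhamel {H : HilbertSpace} (S : R -> H -> H) (x : H) (f : R -> H)
    (U : R -> H) (t : R) : Prop :=
  ex_RInt (fun s => S (t - s) (f s)) 0 t /\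
  U t = plus (S t x) (RInt (fun s => S (t - s) (f s)) 0 t).

(* Mild solution on [0, +oo) of U' = A U + f, where A generates S. *)
Definition mild_solution {H : HilbertSpace} (S : R -> H -> H) (f : R -> H)
    (U : R -> H) : Prop :=
  continuous_on (fun t => 0 <= t) U /\
  forall t, 0 <= t -> duhamel S (U 0) f U t.

Definition delay_term {H : HilbertSpace} (I : nat) (tau : nat -> R)
    (F : nat -> H -> H -> H) (U : R -> H) (s : R) : H :=
  sum_n_m (fun i => F i (U s) (U (s - tau i))) 1 I.

(* The history is carried by the values of [U] on (-tau_1, 0]; those on
   (-oo, -tau_1] are irrelevant: U (-tau_1) enters the Duhamel integrand only at
   the endpoint s = 0. *)
Definition delay_mild_solution {H : HilbertSpace} (S : R -> H -> H) (I : nat)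
    (tau : nat -> R) (F : nat -> H -> H -> H) (U0 : R -> H)
    (U : R -> H) : Prop :=
  mild_solution S (delay_term I tau F U) U /\
  forall t, 0 < t <= tau 1%nat -> U (t - tau 1%nat) = U0 t.

(* Main.v *)
Require Import Defs.
From Stdlib Require Import Reals Lra Lia Classical IndefiniteDescription.
From Coquelicot Require Import Coquelicot.
Open Scope R_scope.

(** Functions on the half-line [t >= 0] are joined to the prescribed history
    into functions on the whole line ([prolong]), with [U0 0] for all earlier
    times. A mild solution is then, up to its values at and before [-T],
    a continuous fixed point of
      [E u = prolong T U0 (duhamel_map S (U0 T) (delay_term I tau F u))],
    where [T = tau 1] is the largest delay.

    The proof is Picard's, in the norm weighted by [exp (lam * s)]. If [u] and
    [v] differ by at most [C * exp (lam * s)] up to some time, so do their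
    delayed values, because delays look back to where the weight is smaller;
    hence the nonlinear terms differ by at most [L * C * exp (lam * s)]
    ([delay_term_lipschitz]). As exponential stability bounds the semigroup by
    a constant [M], integrating the weight gives a difference of at most
    [M * L * C / lam * exp (lam * s)] after the Duhamel map
    ([duhamel_map_gap]). With [lam >= 2 * M * L] the map [E] halves weighted
    distances ([solution_operator_contracts]). All functions [E u]
    agree up to time [0], and two continuous functions with the same past have finite
    weighted distance on each bounded horizon, which suffices for a unique
    continuous fixed point ([causal_fixed_point_exists],
    [causal_fixed_point_unique]).

    The analytic input is that the Duhamel integral is continuous in [t]: the
    map [(t, x) |-> S t x] is jointly continuous
    ([semigroup_jointly_continuous]), and integrals with a jointly continuous
    integrand depend continuously on the parameter
    ([continuous_RInt_0_param]). *)

(** * Norms and limits in complete normed modules *)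

Lemma norm_minus_sym {V : CompleteNormedModule R_AbsRing} (x y : V) :
  norm (minus x y) = norm (minus y x).
Proof. rewrite <- opp_minus. exact (norm_opp (V := V) _). Qed.

Lemma norm_minus_triangle {V : CompleteNormedModule R_AbsRing} (z x y : V) :
  norm (minus x y) <= norm (minus x z) + norm (minus z y).
Proof. rewrite (minus_trans z x y). apply (norm_triangle (V := V)). Qed.

Lemma norm_minus_self {V : CompleteNormedModule R_AbsRing} (x : V) : norm (minus x x) = 0.
Proof. rewrite minus_eq_zero. exact (norm_zero (V := V)). Qed.

Lemma minus_plus_plus {G : AbelianGroup} (a b c d : G) :
  minus (plus a b) (plus c d) = plus (minus a c) (minus b d).
Proof.
  unfold minus. rewrite opp_plus, <- !plus_assoc. f_equal.
  rewrite !plus_assoc. f_equal. apply plus_comm.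
Qed.

Lemma minus_plus_cancel_l {G : AbelianGroup} (a b c : G) :
  minus (plus a b) (plus a c) = minus b c.
Proof. rewrite minus_plus_plus, minus_eq_zero. apply plus_zero_l. Qed.

Lemma plus_minus_l {G : AbelianGroup} (a b : G) : plus a (minus b a) = b.
Proof.
  rewrite plus_comm. etransitivity; [|apply minus_zero_r].
  symmetry. etransitivity; [apply (minus_trans a)|]. f_equal. apply minus_zero_r.
Qed.

Lemma eq_of_norm_minus_small {V : CompleteNormedModule R_AbsRing} (x y : V) :
  (forall eps, 0 < eps -> norm (minus x y) < eps) -> x = y.
Proof.
  intros h. apply NNPP. intros ne.
  exact (Rlt_irrefl _ (h _ (norm_minus_gt_0 x y ne))).
Qed.

Lemma filterlim_norm_minus {T : Type} {F : (T -> Prop) -> Prop} {FF : Filter F}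
    {V : CompleteNormedModule R_AbsRing} (f : T -> V) (l : V) :
  filterlim f F (locally l) <->
  (forall eps, 0 < eps -> F (fun x => norm (minus (f x) l) < eps)).
Proof.
  split.
  - intros h eps Heps. apply (h (fun y => norm (minus y l) < eps)).
    apply (locally_le_locally_norm (V := V)). exists (mkposreal eps Heps). now intros y Hy.
  - intros h. apply filterlim_locally. intros eps.
    generalize (h eps (cond_pos eps)). apply filter_imp.
    intros x Hx. now apply (norm_compat1 (V := V)).
Qed.

Lemma filterlim_norm_minus_le {T : Type} {F : (T -> Prop) -> Prop} {FF : Filter F}
    {V : CompleteNormedModule R_AbsRing} (f : T -> V) (l : V) (b : T -> R) :
  filterlim b F (locally 0) -> (forall x, norm (minus (f x) l) <= b x) ->
  filterlim f F (locally l).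
Proof.
  intros hb hfb. apply (filterlim_norm_minus (V := V)). intros eps Heps.
  generalize (proj1 (filterlim_norm_minus (V := R_CompleteNormedModule) b 0) hb eps Heps).
  apply filter_imp. intros x Hx.
  apply Rle_lt_trans with (1 := hfb x).
  change (Rabs (b x - 0) < eps) in Hx. apply Rabs_def2 in Hx. lra.
Qed.

Lemma filterlim_norm_minus_self {T : Type} {F : (T -> Prop) -> Prop} {FF : Filter F}
    {V : CompleteNormedModule R_AbsRing} (f : T -> V) (l : V) :
  filterlim f F (locally l) ->
  filterlim (fun x => norm (minus (f x) l)) F (locally 0).
Proof.
  intros h. apply (filterlim_norm_minus (V := R_CompleteNormedModule)). intros eps Heps.
  generalize (proj1 (filterlim_norm_minus f l) h eps Heps). apply filter_imp.
  intros x Hx. change (Rabs (norm (minus (f x) l) - 0) < eps).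
  rewrite Rminus_0_r, Rabs_pos_eq; [exact Hx | apply (norm_ge_0 (V := V))].
Qed.

Lemma filterlim_add_zero {T : Type} {F : (T -> Prop) -> Prop} {FF : Filter F}
    (a b : T -> R) :
  filterlim a F (locally 0) -> filterlim b F (locally 0) ->
  filterlim (fun x => a x + b x) F (locally 0).
Proof.
  intros ha hb. rewrite <- (Rplus_0_r 0) at 1.
  exact (filterlim_comp_2 _ _ _ ha hb (filterlim_plus (V := R_CompleteNormedModule) 0 0)).
Qed.

Lemma filterlim_mult_zero {T : Type} {F : (T -> Prop) -> Prop} {FF : Filter F}
    (k : R) (a : T -> R) :
  filterlim a F (locally 0) -> filterlim (fun x => k * a x) F (locally 0).
Proof.
  intros ha. rewrite <- (Rmult_0_r k) at 1.
  exact (filterlim_comp _ _ _ _ _ _ _ _ ha (filterlim_scal_r (V := R_CompleteNormedModule) k 0)).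
Qed.

Lemma continuous_Rmax_const {W : UniformSpace} (f : W -> R) (c : R) (x : W) :
  continuous f x -> continuous (fun y => Rmax (f y) c) x.
Proof.
  intros hf.
  apply (filterlim_norm_minus_le (V := R_CompleteNormedModule) _ _
           (fun y => Rabs (f y - f x))).
  - exact (filterlim_norm_minus_self (V := R_CompleteNormedModule) f (f x) hf).
  - intros y. change (Rabs (Rmax (f y) c - Rmax (f x) c) <= Rabs (f y - f x)).
    unfold Rmax, Rabs.
    destruct (Rle_dec (f y) c), (Rle_dec (f x) c);
      repeat destruct Rcase_abs; lra.
Qed.

Lemma continuous_on_comp {W : UniformSpace} {V : UniformSpace} (D : R -> Prop)
    (f : R -> V) (c : W -> R) (x : W) :
  continuous_on D f -> (forall y, D (c y)) -> continuous c x ->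
  continuous (fun y => f (c y)) x.
Proof.
  intros hf hD hc.
  unfold continuous. eapply filterlim_comp; [| exact (hf _ (hD x))].
  intros P HP. change (locally x (fun y => P (c y))).
  assert (h : locally x (fun y => D (c y) -> P (c y))) by exact (hc _ HP).
  revert h. apply filter_imp. auto.
Qed.

(** * Integrals depending on a parameter *)

(** Continuity in [t] at [t0] is uniform over a compact interval of values of
    [s]: the neighbourhoods on which joint continuity at the points
    [(t0, s)] gives [eps / 2] have a Lebesgue number. *)
Lemma jointly_continuous_tube {V : CompleteNormedModule R_AbsRing} (g : R -> R -> V) (a b t0 : R) :
  (forall s, continuous (fun p : R * R => g (fst p) (snd p)) (t0, s)) ->
  forall eps, 0 < eps ->
  locally t0 (fun t => forall s, a <= s <= b -> norm (minus (g t s) (g t0 s)) < eps).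
Proof.
  intros hg eps Heps.
  assert (hloc : forall s, exists d : posreal, forall t s',
      Rabs (t - t0) < d -> Rabs (s' - s) < d ->
      norm (minus (g t s') (g t0 s)) < eps / 2).
  { intros s. assert (He : 0 < eps / 2) by lra.
    destruct (proj1 (filterlim_norm_minus _ _) (hg s) _ He) as [d Hd].
    exists d. intros t s' Ht Hs. apply (Hd (t, s')). now split. }
  destruct (functional_choice _ hloc) as [delta Hdelta].
  destruct (compactness_value_1d a b delta) as [d Hd].
  exists d. intros t Ht s Hs. apply NNPP. intros Hn. apply (Hd s Hs).
  intros [c [_ [Hsc Hdc]]]. apply Hn.
  change (Rabs (t - t0) < d) in Ht.
  apply Rle_lt_trans with (1 := norm_minus_triangle (g t0 c) _ _).
  rewrite (norm_minus_sym (g t0 c)).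
  assert (h1 := Hdelta c t s ltac:(lra) Hsc).
  assert (h2 := Hdelta c t0 s).
  rewrite Rminus_eq_0, Rabs_R0 in h2.
  specialize (h2 (cond_pos _) Hsc). lra.
Qed.

Lemma continuous_slice {V : UniformSpace} (g : R -> R -> V) (t s : R) :
  continuous (fun p : R * R => g (fst p) (snd p)) (t, s) -> continuous (g t) s.
Proof.
  intros h.
  apply (continuous_comp_2 (fun _ => t) (fun r => r) (fun x y => g x y) s).
  - apply continuous_const.
  - apply continuous_id.
  - exact h.
Qed.

Lemma continuous_RInt_param {V : CompleteNormedModule R_AbsRing} (g : R -> R -> V)
    (a b : R) (hab : a <= b) :
  (forall t s, continuous (fun p : R * R => g (fst p) (snd p)) (t, s)) ->
  forall t, continuous (fun t => RInt (g t) a b) t.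
Proof.
  intros hg t.
  assert (hex : forall t, ex_RInt (g t) a b).
  { intros t'. apply ex_RInt_continuous. intros s _. now apply continuous_slice. }
  apply (filterlim_norm_minus (V := V)). intros eps Heps.
  assert (He : 0 < eps / (b - a + 1)) by (apply Rdiv_lt_0_compat; lra).
  generalize (jointly_continuous_tube g a b t (hg t) _ He). apply filter_imp.
  intros t' Ht'.
  change (norm (minus (RInt (g t') a b) (RInt (g t) a b)) < eps).
  rewrite <- (RInt_minus (g t') (g t) a b (hex t') (hex t)).
  apply Rle_lt_trans with ((b - a) * (eps / (b - a + 1))).
  - apply (norm_RInt_le_const (fun s => minus (g t' s) (g t s)) a b _ _ hab).
    + intros s Hs. apply Rlt_le. now apply Ht'.
    + apply RInt_correct. now apply ex_RInt_minus.
  - apply Rlt_le_trans with ((b - a + 1) * (eps / (b - a + 1))).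
    + apply Rmult_lt_compat_r; lra.
    + right. field. lra.
Qed.

(** The substitution [s = t * r] moves the variable bound into the integrand,
    over the fixed interval from [0] to [1]; it is valid for either sign of [t]. *)
Lemma continuous_RInt_0_param {V : CompleteNormedModule R_AbsRing} (g : R -> R -> V) :
  (forall t s, continuous (fun p : R * R => g (fst p) (snd p)) (t, s)) ->
  forall t, continuous (fun t => RInt (g t) 0 t) t.
Proof.
  intros hg t.
  apply (continuous_ext (fun t : R => RInt (fun r : R => scal t (g t (t * r))) 0 1)).
  - intros t'.
    replace (RInt (g t') 0 t') with (RInt (g t') (t' * 0 + 0) (t' * 1 + 0))
      by (f_equal; ring).
    rewrite <- RInt_comp_lin.
    + apply RInt_ext. intros r _. now rewrite Rplus_0_r.
    + apply ex_RInt_continuous. intros s _. now apply continuous_slice.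
  - apply (continuous_RInt_param (fun t r : R => scal t (g t (t * r)))); [lra|].
    intros t' r. apply (continuous_scal (V := V) (fun p : R * R => fst p)
             (fun p => g (fst p) (fst p * snd p))).
    + apply continuous_fst.
    + apply (continuous_comp_2 (fun p : R * R => fst p) (fun p => fst p * snd p)
               (fun x y => g x y)).
      * apply continuous_fst.
      * apply (continuous_mult (fun p : R * R => fst p) (fun p => snd p)).
        apply continuous_fst. apply continuous_snd.
      * apply hg.
Qed.

(** * A fixed point theorem for causal maps on the half-line *)

Lemma pow_half_small (K eps : R) : 0 < eps -> exists n : nat, K * (1 / 2) ^ n < eps.
Proof.
  intros Heps.
  assert (hK : 0 < Rabs K + 1) by (assert (h := Rabs_pos K); lra).
  destruct (pow_lt_1_zero (1 / 2) ltac:(rewrite Rabs_pos_eq; lra) (eps / (Rabs K + 1)))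
    as [N HN]; [now apply Rdiv_lt_0_compat|].
  exists N. specialize (HN N (Nat.le_refl N)).
  assert (hp : 0 < (1 / 2) ^ N) by (apply pow_lt; lra).
  rewrite Rabs_pos_eq in HN by lra.
  apply (Rmult_lt_compat_l _ _ _ hK) in HN.
  replace ((Rabs K + 1) * (eps / (Rabs K + 1))) with eps in HN by (field; lra).
  apply Rle_lt_trans with (2 := HN).
  apply Rmult_le_compat_r; [lra|]. assert (h := Rle_abs K). lra.
Qed.

(** The bound is asserted for every admissible [D], not only for [C]: below,
    the limit at a time [s] is chosen once, and the constant controlling the
    steps then depends on the horizon [T >= s] under consideration. *)
Lemma geometric_steps_limit {V : CompleteNormedModule R_AbsRing} (x : nat -> V) (C : R) :
  (forall n, norm (minus (x (S n)) (x n)) <= C * (1 / 2) ^ n) ->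
  exists l : V, forall D, (forall n, norm (minus (x (S n)) (x n)) <= D * (1 / 2) ^ n) ->
      forall n, norm (minus l (x n)) <= 2 * D * (1 / 2) ^ n.
Proof.
  intros hC.
  assert (hsum : forall D, (forall n, norm (minus (x (S n)) (x n)) <= D * (1 / 2) ^ n) ->
    forall n k, norm (minus (x (n + k)%nat) (x n))
                <= 2 * D * (1 / 2) ^ n * (1 - (1 / 2) ^ k)).
  { intros D hD n k. induction k as [|k IH].
    - rewrite Nat.add_0_r, (norm_minus_self (V := V)). simpl. lra.
    - rewrite Nat.add_succ_r.
      apply Rle_trans with (1 := norm_minus_triangle (x (n + k)%nat) _ _).
      specialize (hD (n + k)%nat). rewrite pow_add in hD. simpl. lra. }
  assert (hpos : forall D, (forall n, norm (minus (x (S n)) (x n)) <= D * (1 / 2) ^ n) -> 0 <= D).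
  { intros D hD. specialize (hD 0%nat). simpl in hD.
    assert (h := norm_ge_0 (minus (x 1%nat) (x 0%nat))). lra. }
  assert (hbound : forall D, (forall n, norm (minus (x (S n)) (x n)) <= D * (1 / 2) ^ n) ->
    forall n m, (n <= m)%nat -> norm (minus (x m) (x n)) <= 2 * D * (1 / 2) ^ n).
  { intros D hD n m hnm. replace m with (n + (m - n))%nat by lia.
    apply Rle_trans with (1 := hsum D hD n (m - n)%nat).
    assert (hk : 0 < (1 / 2) ^ (m - n)) by (apply pow_lt; lra).
    assert (hn : 0 < (1 / 2) ^ n) by (apply pow_lt; lra).
    assert (h : 0 <= 2 * D * (1 / 2) ^ n).
    { apply Rmult_le_pos; [specialize (hpos D hD)|]; lra. }
    apply Rle_trans with (2 * D * (1 / 2) ^ n * 1); [|lra].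
    apply Rmult_le_compat_l; lra. }
  destruct (proj1 (filterlim_locally_cauchy (F := eventually) x)) as [l Hl].
  { intros eps. destruct (pow_half_small (4 * C) eps (cond_pos eps)) as [N HN].
    exists (fun n => (N <= n)%nat). split; [now exists N|].
    intros n m hn hm. apply (norm_compat1 (V := V)).
    apply Rle_lt_trans with (1 := norm_minus_triangle (x N) _ _).
    rewrite (norm_minus_sym (x N)).
    assert (h1 := hbound C hC N n hn). assert (h2 := hbound C hC N m hm). lra. }
  exists l. intros D hD n.
  apply le_epsilon. intros eps Heps.
  destruct (proj1 (filterlim_norm_minus x l) Hl eps Heps) as [N HN].
  apply Rle_trans with (1 := norm_minus_triangle (x (N + n)%nat) _ _).
  rewrite (norm_minus_sym l).
  assert (h1 := HN (N + n)%nat ltac:(lia)).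
  assert (h2 := hbound D hD n (N + n)%nat ltac:(lia)). lra.
Qed.

(** The weight [exp (lam * s)] turns an integral operator on the whole half-line
    into a contraction when [lam] is large. The estimate is asked on each
    half-line [s <= T] separately: no growth at infinity is then required of
    [u] and [v], and uniqueness holds among all continuous functions. *)
Definition causal_half_contraction {V : CompleteNormedModule R_AbsRing} (lam : R)
    (E : (R -> V) -> R -> V) : Prop :=
  forall (u v : R -> V) (C T : R),
    (forall s, continuous u s) -> (forall s, continuous v s) ->
    (forall s, s <= T -> norm (minus (u s) (v s)) <= C * exp (lam * s)) ->
    forall s, s <= T -> norm (minus (E u s) (E v s)) <= C * (1 / 2) * exp (lam * s).

(** Starting point of both halves of the fixed point theorem: between [0] and [T]
    the bound comes from compactness, and up to time [0] there is nothing to bound. *)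
Lemma weighted_gap_bounded {V : CompleteNormedModule R_AbsRing} (lam : R) (u v : R -> V) :
  (forall s, continuous u s) -> (forall s, continuous v s) ->
  (forall s, s <= 0 -> u s = v s) ->
  forall T, exists C, 0 <= C /\
    forall s, s <= T -> norm (minus (u s) (v s)) <= C * exp (lam * s).
Proof.
  intros hu hv huv T.
  destruct (bounded_continuity (V := V)
    (fun s => scal (exp (- (lam * s))) (minus (u s) (v s))) 0 T) as [B HB].
  { intros s _. apply (continuous_scal (V := V) (fun s => exp (- (lam * s)))
             (fun s => minus (u s) (v s))).
    - apply (ex_derive_continuous (V := R_CompleteNormedModule)). auto_derive. trivial.
    - now apply (continuous_minus (V := V) u v). }
  exists (Rmax 0 B). split; [apply Rmax_l|]. intros s hs.
  assert (he := exp_pos (lam * s)).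
  destruct (Rle_lt_dec s 0) as [hs0|hs0].
  - rewrite (huv s hs0), norm_minus_self.
    apply Rmult_le_pos; [apply Rmax_l|lra].
  - replace (minus (u s) (v s))
      with (scal (exp (lam * s)) (scal (exp (- (lam * s))) (minus (u s) (v s)))).
    + apply Rle_trans with (1 := norm_scal (V := V) _ _).
      change (abs (exp (lam * s))) with (Rabs (exp (lam * s))).
      rewrite Rabs_pos_eq, Rmult_comm by lra.
      apply Rmult_le_compat_r; [lra|].
      apply Rle_trans with (2 := Rmax_r 0 B).
      apply Rlt_le, HB. lra.
    + rewrite scal_assoc.
      change (mult (exp (lam * s)) (exp (- (lam * s))))
        with (exp (lam * s) * exp (- (lam * s))).
      rewrite <- exp_plus, Rplus_opp_r, exp_0. apply (scal_one (V := V)).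
Qed.

Section FixedPoint.
Context {V : CompleteNormedModule R_AbsRing} (lam : R) (E : (R -> V) -> R -> V)
  (Econt : forall u, (forall s, continuous u s) -> forall s, continuous (E u) s)
  (Econtr : causal_half_contraction lam E)
  (Ehist : forall u v t, t <= 0 -> E u t = E v t).

(** Applying [E] repeatedly to the a priori bound on [s <= t] halves it each
    time. *)
Lemma causal_fixed_point_unique (u v : R -> V) :
  (forall s, continuous u s) -> (forall s, continuous v s) ->
  (forall t, E u t = u t) -> (forall t, E v t = v t) -> forall t, u t = v t.
Proof.
  intros hu hv fu fv t.
  destruct (weighted_gap_bounded lam u v hu hv) with (T := t) as [C [hC0 hC]].
  { intros s hs. now rewrite <- fu, <- fv, (Ehist u v). }
  assert (hn : forall n s, s <= t ->
     norm (minus (u s) (v s)) <= C * (1 / 2) ^ n * exp (lam * s)).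
  { induction n as [|n IH]; intros s hs.
    - simpl. rewrite Rmult_1_r. now apply hC.
    - rewrite <- fu, <- fv. simpl.
      replace (C * (1 / 2 * (1 / 2) ^ n)) with (C * (1 / 2) ^ n * (1 / 2)) by ring.
      now apply (Econtr u v _ t). }
  apply eq_of_norm_minus_small. intros eps Heps.
  destruct (pow_half_small (C * exp (lam * t)) eps Heps) as [n Hn].
  specialize (hn n t (Rle_refl t)). lra.
Qed.

(** Picard iteration from the zero function. From the first step on, the
    iterates share their values before time [0], so consecutive iterates differ
    by at most [C * (1 / 2) ^ n * exp (lam * s)] on [s <= T], with [C] depending on [T]
    only. The limit is therefore locally uniform, hence continuous, and [E]
    passes to the limit by contraction. *)
Lemma causal_fixed_point_exists :
  exists u : R -> V, (forall s, continuous u s) /\ forall t, E u t = u t.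
Proof.
  (* One application of [E] is made before counting, so that [x 0] already
     carries the common history. *)
  set (x := fun n => Nat.iter (S n) E (fun _ => zero)).
  assert (hx : forall n s, continuous (x n) s).
  { induction n as [|n IH]; intros s; apply Econt; [|exact IH].
    intros s'. apply continuous_const. }
  assert (hstep : forall T, exists C, 0 <= C /\ forall n s, s <= T ->
     norm (minus (x (S n) s) (x n s)) <= C * exp (lam * s) * (1 / 2) ^ n).
  { intros T.
    destruct (weighted_gap_bounded lam (x 1%nat) (x 0%nat) (hx 1%nat) (hx 0%nat))
      with (T := T) as [C [hC0 hC]].
    { intros s hs. now apply Ehist. }
    exists C. split; [exact hC0|]. induction n as [|n IH]; intros s hs.
    - simpl (_ ^ 0). rewrite Rmult_1_r. now apply hC.
    - replace (C * exp (lam * s) * (1 / 2) ^ S n)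
        with (C * (1 / 2) ^ n * (1 / 2) * exp (lam * s)) by (simpl; ring).
      apply (Econtr (x (S n)) (x n) _ T); auto.
      intros r hr. replace (C * (1 / 2) ^ n * exp (lam * r))
        with (C * exp (lam * r) * (1 / 2) ^ n) by ring. now apply IH. }
  assert (hlim : forall s, exists l : V,
     forall D, (forall n, norm (minus (x (S n) s) (x n s)) <= D * (1 / 2) ^ n) ->
      forall n, norm (minus l (x n s)) <= 2 * D * (1 / 2) ^ n).
  { intros s. destruct (hstep s) as [C [_ hC]].
    destruct (geometric_steps_limit (fun n => x n s) (C * exp (lam * s))) as [l Hl].
    - intros n. apply hC. lra.
    - now exists l. }
  destruct (functional_choice _ hlim) as [u Hu].
  assert (hux : forall T, exists C, 0 <= C /\ forall n s, s <= T ->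
     norm (minus (u s) (x n s)) <= 2 * C * (1 / 2) ^ n * exp (lam * s)).
  { intros T. destruct (hstep T) as [C [hC0 hC]]. exists C. split; [exact hC0|].
    intros n s hs.
    apply Rle_trans with (1 := Hu s _ (fun n => hC n s hs) n). right. ring. }
  (* The geometric factor beats the weight uniformly near each point. *)
  assert (hexp : forall K s eps, 0 <= K -> 0 < eps -> exists n : nat,
     locally s (fun r => K * (1 / 2) ^ n * exp (lam * r) < eps)).
  { intros K s eps hK Heps.
    destruct (pow_half_small (K * (exp (lam * s) + 1)) eps Heps) as [n Hn].
    exists n.
    assert (hc : continuous (fun r => exp (lam * r)) s).
    { apply (ex_derive_continuous (V := R_CompleteNormedModule)). auto_derive. trivial. }
    generalize (proj1 (filterlim_norm_minus (V := R_CompleteNormedModule) _ _) hc 1 Rlt_0_1).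
    apply filter_imp. intros r hr. change (Rabs (exp (lam * r) - exp (lam * s)) < 1) in hr.
    apply Rabs_def2 in hr.
    apply Rle_lt_trans with (2 := Hn).
    replace (K * (exp (lam * s) + 1) * (1 / 2) ^ n)
      with (K * (1 / 2) ^ n * (exp (lam * s) + 1)) by ring.
    apply Rmult_le_compat_l; [|lra].
    apply Rmult_le_pos; [exact hK|]. apply pow_le. lra. }
  assert (hu : forall s, continuous u s).
  { intros t. apply (filterlim_norm_minus (V := V)). intros eps Heps.
    assert (He3 : 0 < eps / 3) by lra.
    destruct (hux (t + 1)) as [C [hC0 hC]].
    destruct (hexp (2 * C) t (eps / 3) ltac:(lra) He3) as [n Hn].
    assert (ht := locally_singleton _ _ Hn). simpl in ht.
    assert (hT : locally t (fun r => r <= t + 1)).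
    { exists (mkposreal 1 Rlt_0_1). intros r hr. change (Rabs (r - t) < 1) in hr.
      apply Rabs_def2 in hr. lra. }
    generalize (filter_and _ _ (filter_and _ _ Hn hT)
      (proj1 (filterlim_norm_minus (V := V) _ _) (hx n t) _ He3)).
    apply filter_imp. intros r [[h1 h2] h3].
    apply Rle_lt_trans with (1 := norm_minus_triangle (x n r) _ _).
    assert (h4 := norm_minus_triangle (x n t) (x n r) (u t)).
    assert (h5 := hC n r h2). assert (h6 := hC n t ltac:(lra)).
    rewrite norm_minus_sym in h6. lra. }
  exists u. split; [exact hu|]. intros t.
  apply eq_of_norm_minus_small. intros eps Heps.
  destruct (hux t) as [C [hC0 hC]].
  destruct (hexp (2 * C) t (eps / 2) ltac:(lra) ltac:(lra)) as [n Hn].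
  apply locally_singleton in Hn.
  apply Rle_lt_trans with (1 := norm_minus_triangle (x (S n) t) _ _).
  assert (h1 := Econtr u (x n) (2 * C * (1 / 2) ^ n) t hu (hx n) (hC n) t (Rle_refl t)).
  change (E (x n) t) with (x (S n) t) in h1.
  assert (h2 := hC (S n) t (Rle_refl t)). rewrite norm_minus_sym in h2. simpl in h2. lra.
Qed.

End FixedPoint.

(** * The Duhamel map of a bounded semigroup *)

Section Semigroup.
Context {H : HilbertSpace} (S : R -> H -> H) (hS : C0_semigroup S).

Lemma semigroup_bounded : exponentially_stable S ->
  exists M, 0 < M /\ forall t x, 0 <= t -> norm (S t x) <= M * norm x.
Proof.
  intros [M [om [hM [hom hb]]]]. exists M. split; [exact hM|]. intros t x ht.
  assert (hlin := semigroup_linear S hS t ht).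
  destruct (Req_dec (norm x) 0) as [h0|h0].
  - apply norm_eq_zero in h0. rewrite h0, (linear_zero _ hlin).
    rewrite (norm_zero (V := H)). lra.
  - assert (hx : 0 < norm x) by (assert (h := norm_ge_0 x); lra).
    set (y := scal (/ norm x) x).
    assert (hxy : x = scal (norm x) y).
    { unfold y. rewrite scal_assoc. change (mult (norm x) (/ norm x)) with (norm x * / norm x).
      rewrite Rinv_r by lra. symmetry. apply (scal_one (V := H)). }
    assert (hy : norm y <= 1).
    { apply Rle_trans with (1 := norm_scal (V := H) _ _).
      change (Rabs (/ norm x) * norm x <= 1).
      rewrite Rabs_pos_eq; [right; field; lra|]. apply Rlt_le, Rinv_0_lt_compat, hx. }
    assert (hSy : norm (S t y) <= M).
    { assert (h : Rbar_le (norm (S t y)) (M * exp (- om * t))).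
      { apply Rbar_le_trans with (2 := hb t ht).
        apply (proj1 (Lub_Rbar_correct _)). now exists y. }
      simpl in h. apply Rle_trans with (1 := h).
      rewrite <- (Rmult_1_r M) at 2. apply Rmult_le_compat_l; [lra|].
      rewrite <- exp_0. destruct ht as [ht|<-].
      - apply Rlt_le, exp_increasing. rewrite <- Ropp_mult_distr_l.
        assert (0 < om * t) by now apply Rmult_lt_0_compat. lra.
      - right. f_equal. ring. }
    rewrite hxy at 1. rewrite (linear_scal _ hlin).
    apply Rle_trans with (1 := norm_scal (V := H) _ _).
    change (Rabs (norm x) * norm (S t y) <= M * norm x).
    rewrite Rabs_pos_eq by lra. rewrite Rmult_comm.
    apply Rmult_le_compat_r; lra.
Qed.

Context (M : R) (hM : forall t x, 0 <= t -> norm (S t x) <= M * norm x).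

Lemma semigroup_minus t x y : 0 <= t -> S t (minus x y) = minus (S t x) (S t y).
Proof.
  intros ht. assert (hlin := semigroup_linear S hS t ht).
  unfold minus. rewrite (linear_plus _ hlin). f_equal.
  exact (linear_opp _ _ hlin).
Qed.

(** By the semigroup law the larger time is the smaller one followed by
    [|a - b|]; strong continuity at [0] thus gives continuity, even uniform, in
    time on the whole half-line. *)
Lemma semigroup_gap a b x : 0 <= a -> 0 <= b ->
  norm (minus (S a x) (S b x)) <= M * norm (minus (S (Rabs (a - b)) x) x).
Proof.
  assert (hle : forall a b, 0 <= a -> a <= b ->
    norm (minus (S b x) (S a x)) <= M * norm (minus (S (b - a) x) x)).
  { intros a' b' ha hab. replace b' with (a' + (b' - a')) at 1 by ring.
    rewrite (semigroup_plus S hS) by lra.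
    rewrite <- semigroup_minus by exact ha. now apply hM. }
  intros ha hb. destruct (Rle_lt_dec a b) as [hab|hab].
  - rewrite norm_minus_sym, Rabs_minus_sym, Rabs_pos_eq by lra. now apply hle.
  - rewrite Rabs_pos_eq by lra. apply hle; lra.
Qed.

Lemma semigroup_small_time x eps : 0 < eps ->
  exists d : posreal, forall h, 0 <= h < d -> norm (minus (S h x) x) < eps.
Proof.
  intros Heps.
  destruct (proj1 (filterlim_norm_minus _ _) (semigroup_continuous S hS x) eps Heps)
    as [d Hd].
  exists d. intros h [h0 hd]. destruct h0 as [h0|<-].
  - apply Hd; [|exact h0]. change (Rabs (h - 0) < d).
    rewrite Rminus_0_r, Rabs_pos_eq; lra.
  - rewrite (semigroup_0 S hS), norm_minus_self. exact Heps.
Qed.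

(** Stated for maps into the domain of [S], because [S] has no meaning at
    negative times and continuity on a neighbourhood of [0] cannot be asked. *)
Lemma semigroup_jointly_continuous {W : UniformSpace} (a : W -> R) (b : W -> H) (p : W) :
  (forall q, 0 <= a q) -> continuous a p -> continuous b p ->
  continuous (fun q => S (a q) (b q)) p.
Proof.
  intros ha hca hcb.
  apply (filterlim_norm_minus_le (V := H) _ _ (fun q =>
    M * norm (minus (b q) (b p))
    + M * norm (minus (S (Rabs (a q - a p)) (b p)) (b p)))).
  - apply filterlim_add_zero; apply filterlim_mult_zero.
    + now apply filterlim_norm_minus_self.
    + apply (filterlim_norm_minus_self (V := H) (fun q => S (Rabs (a q - a p)) (b p))).
      apply (filterlim_norm_minus (V := H)). intros eps Heps.
      destruct (semigroup_small_time (b p) eps Heps) as [d Hd].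
      generalize (proj1 (filterlim_norm_minus (V := R_CompleteNormedModule) _ _) hca d
                    (cond_pos d)).
      apply filter_imp. intros q hq. apply Hd. split; [apply Rabs_pos | exact hq].
  - intros q. apply Rle_trans with (1 := norm_minus_triangle (S (a q) (b p)) _ _).
    apply Rplus_le_compat.
    + rewrite <- semigroup_minus by auto. now apply hM.
    + now apply semigroup_gap.
Qed.

Definition duhamel_map (x : H) (w : R -> H) (t : R) : H :=
  plus (S t x) (RInt (fun s => S (t - s) (w s)) 0 t).

(** Clamping [t - s] at [0] changes nothing on the triangle [0 <= s <= t] where
    the kernel is integrated, and makes it continuous on the whole plane. *)
Lemma duhamel_kernel_continuous (w : R -> H) : (forall s, continuous w s) ->
  forall t s, continuous (fun p : R * R => S (Rmax (fst p - snd p) 0) (w (snd p))) (t, s).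
Proof.
  intros hw t s.
  apply (semigroup_jointly_continuous (fun p : R * R => Rmax (fst p - snd p) 0)
           (fun p => w (snd p))).
  - intros q. apply Rmax_r.
  - apply (continuous_Rmax_const (fun p : R * R => fst p - snd p)).
    apply (continuous_minus (V := R_NormedModule) (fun p : R * R => fst p) snd).
    apply continuous_fst. apply continuous_snd.
  - apply (continuous_comp (fun p : R * R => snd p) w).
    apply continuous_snd. apply hw.
Qed.

Lemma ex_RInt_duhamel (w : R -> H) : (forall s, continuous w s) ->
  forall t, 0 <= t -> ex_RInt (fun s => S (t - s) (w s)) 0 t.
Proof.
  intros hw t ht.
  apply (ex_RInt_ext (fun s => S (Rmax (t - s) 0) (w s))).
  - intros s hs. rewrite Rmin_left, Rmax_right in hs by exact ht.
    rewrite Rmax_left by lra. reflexivity.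
  - apply ex_RInt_continuous. intros s _.
    apply (continuous_slice (fun t s => S (Rmax (t - s) 0) (w s))).
    now apply duhamel_kernel_continuous.
Qed.

Lemma duhamel_map_continuous (x : H) (w : R -> H) : (forall s, continuous w s) ->
  forall t, continuous (fun t => duhamel_map x w (Rmax t 0)) t.
Proof.
  intros hw t.
  assert (hm : continuous (fun t => Rmax t 0) t).
  { apply (continuous_Rmax_const (fun t : R => t)), continuous_id. }
  apply (continuous_ext (fun t => plus (S (Rmax t 0) x)
    (RInt (fun s => S (Rmax (Rmax t 0 - s) 0) (w s)) 0 (Rmax t 0)))).
  - intros t'. unfold duhamel_map. f_equal. apply RInt_ext. intros s hs.
    rewrite Rmin_left, Rmax_right in hs by apply Rmax_r.
    rewrite (Rmax_left (_ - s)) by lra. reflexivity.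
  - apply (continuous_plus (V := H) (fun t => S (Rmax t 0) x)
      (fun t => RInt (fun s => S (Rmax (Rmax t 0 - s) 0) (w s)) 0 (Rmax t 0))).
    + apply (semigroup_jointly_continuous (fun t => Rmax t 0) (fun _ => x)).
      * intros q. apply Rmax_r.
      * exact hm.
      * apply continuous_const.
    + apply (continuous_comp (fun t => Rmax t 0)
        (fun r => RInt (fun s => S (Rmax (r - s) 0) (w s)) 0 r)).
      * exact hm.
      * apply (continuous_RInt_0_param (fun r s => S (Rmax (r - s) 0) (w s))).
        now apply duhamel_kernel_continuous.
Qed.

(** The gain [1 / lam] is the integral of the weight:
    [lam * int_0^t exp (lam * s) ds <= exp (lam * t)]. *)
Lemma duhamel_map_gap (x : H) (w1 w2 : R -> H) (K lam t : R) :
  0 <= M -> 0 < lam -> 0 <= K -> 0 <= t ->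
  (forall s, continuous w1 s) -> (forall s, continuous w2 s) ->
  (forall s, s <= t -> norm (minus (w1 s) (w2 s)) <= K * exp (lam * s)) ->
  norm (minus (duhamel_map x w1 t) (duhamel_map x w2 t)) <= M * K / lam * exp (lam * t).
Proof.
  intros hM0 hlam hK ht hw1 hw2 hgap. unfold duhamel_map.
  rewrite (minus_plus_cancel_l (G := H)).
  assert (h1 := ex_RInt_duhamel w1 hw1 t ht). assert (h2 := ex_RInt_duhamel w2 hw2 t ht).
  rewrite <- (RInt_minus _ _ _ _ h1 h2).
  set (G := fun s => M * K / lam * exp (lam * s)).
  apply Rle_trans with (minus (G t) (G 0)).
  - apply (norm_RInt_le (V := H) (fun s => minus (S (t - s) (w1 s)) (S (t - s) (w2 s)))
             (fun s => M * (K * exp (lam * s))) 0 t); [exact ht | | |].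
    + intros s hs. rewrite <- semigroup_minus by lra.
      apply Rle_trans with (M * norm (minus (w1 s) (w2 s))); [apply hM; lra|].
      apply Rmult_le_compat_l; [exact hM0|]. apply hgap. lra.
    + apply RInt_correct. now apply (ex_RInt_minus (V := H)).
    + apply (is_RInt_derive (V := R_CompleteNormedModule) G).
      * intros s _. unfold G. auto_derive; [trivial|]. field. lra.
      * intros s _. apply (ex_derive_continuous (V := R_NormedModule)).
        auto_derive. trivial.
  - change (G t - G 0 <= G t).
    assert (0 <= G 0); [|lra]. unfold G.
    apply Rmult_le_pos; [|apply Rlt_le, exp_pos].
    apply Rmult_le_pos; [now apply Rmult_le_pos|]. now apply Rlt_le, Rinv_0_lt_compat.
Qed.

End Semigroup.

Lemma duhamel_map_agree {H : HilbertSpace} (S : R -> H -> H) (x : H) (w1 w2 : R -> H) t :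
  0 <= t -> (forall s, 0 < s < t -> w1 s = w2 s) ->
  duhamel_map S x w1 t = duhamel_map S x w2 t.
Proof.
  intros ht hw. unfold duhamel_map. f_equal. apply RInt_ext. intros s hs.
  rewrite Rmin_left, Rmax_right in hs by exact ht. now rewrite hw.
Qed.

Lemma duhamel_map_0 {H : HilbertSpace} (S : R -> H -> H) (hS : C0_semigroup S)
  (x : H) (w : R -> H) : duhamel_map S x w 0 = x.
Proof.
  unfold duhamel_map. rewrite (semigroup_0 S hS), RInt_point.
  apply (plus_zero_r (G := H)).
Qed.

(** * The delayed nonlinearity *)

Section Delay.
Context {H : HilbertSpace} (tau : nat -> R) (F : nat -> H -> H -> H).

Lemma delay_term_lipschitz (I : nat)
  (hF : forall i, (1 <= i <= I)%nat -> exists gamma : R, 0 < gamma /\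
     forall U1 U2 V1 V2 : H,
       norm (minus (F i U1 U2) (F i V1 V2)) <=
         gamma * (norm (minus U1 V1) + norm (minus U2 V2))) :
  exists L, 0 <= L /\ forall (u v : R -> H) s D,
    norm (minus (u s) (v s)) <= D ->
    (forall i, (1 <= i <= I)%nat -> norm (minus (u (s - tau i)) (v (s - tau i))) <= D) ->
    norm (minus (delay_term I tau F u s) (delay_term I tau F v s)) <= L * D.
Proof.
  unfold delay_term. induction I as [|I IH].
  - exists 0. split; [lra|]. intros. rewrite !sum_n_m_zero by lia.
    rewrite norm_minus_self. lra.
  - destruct IH as [L [hL IH]]. { intros i hi. apply hF. lia. }
    destruct (hF (S I)) as [g [hg Hg]]; [lia|].
    exists (L + 2 * g). split; [lra|]. intros u v s D h0 hi.
    rewrite !sum_n_Sm by lia. rewrite (minus_plus_plus (G := H)).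
    apply Rle_trans with (1 := norm_triangle (V := H) _ _).
    apply Rle_trans with (L * D + g * (D + D)); [|lra].
    apply Rplus_le_compat.
    + apply IH; [exact h0|]. intros i hi'. apply hi. lia.
    + apply Rle_trans with (1 := Hg _ _ _ _). apply Rmult_le_compat_l; [lra|].
      apply Rplus_le_compat; [exact h0|]. apply hi. lia.
Qed.

Lemma delay_term_continuous (I : nat)
  (hF : forall i, (1 <= i <= I)%nat -> exists gamma : R, 0 < gamma /\
     forall U1 U2 V1 V2 : H,
       norm (minus (F i U1 U2) (F i V1 V2)) <=
         gamma * (norm (minus U1 V1) + norm (minus U2 V2))) (u : R -> H) :
  (forall s, continuous u s) -> forall s, continuous (delay_term I tau F u) s.
Proof.
  intros hu s. unfold delay_term. induction I as [|I IH].
  - apply (continuous_ext (fun _ => (zero : H))).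
    + intros t. rewrite sum_n_m_zero by lia. reflexivity.
    + apply continuous_const.
  - apply (continuous_ext (fun s => plus (sum_n_m (fun i => F i (u s) (u (s - tau i))) 1 I)
        (F (S I) (u s) (u (s - tau (S I)))))).
    { intros t. rewrite sum_n_Sm by lia. reflexivity. }
    apply (continuous_plus (V := H)
       (fun s => sum_n_m (fun i => F i (u s) (u (s - tau i))) 1 I)).
    { apply IH. intros i hi. apply hF. lia. }
    destruct (hF (S I)) as [g [hg Hg]]; [lia|].
    apply (filterlim_norm_minus_le (V := H) _ _ (fun t =>
      g * (norm (minus (u t) (u s))
           + norm (minus (u (t - tau (S I))) (u (s - tau (S I))))))).
    + apply filterlim_mult_zero, filterlim_add_zero.
      * apply filterlim_norm_minus_self, hu.
      * apply (filterlim_norm_minus_self (V := H) (fun t => u (t - tau (S I)))).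
        apply (continuous_comp (fun t => t - tau (S I)) u); [|apply hu].
        apply (continuous_minus (V := R_NormedModule) (fun t : R => t) (fun _ => tau (S I))).
        apply continuous_id. apply continuous_const.
    + intros t. apply Hg.
Qed.

End Delay.

Lemma delay_term_agree {H : HilbertSpace} (I : nat) (tau : nat -> R)
    (F : nat -> H -> H -> H) (u v : R -> H) (s : R) :
  u s = v s -> (forall i, (1 <= i <= I)%nat -> u (s - tau i) = v (s - tau i)) ->
  delay_term I tau F u s = delay_term I tau F v s.
Proof.
  intros h0 hi. apply sum_n_m_ext_loc. intros i h. now rewrite h0, hi.
Qed.

(** * Joining the history to a function on the half-line *)

(** Written as a sum, so that continuity needs no argument at the junction. The
    clamps freeze the history at [U0 0] before [-T] and at [U0 T] after [0];
    when [v 0 = U0 T], the second summand vanishes before time [0]. *)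
Definition prolong {H : HilbertSpace} (T : R) (U0 : R -> H) (v : R -> H) (t : R) : H :=
  plus (U0 (Rmax (Rmin T (t + T)) 0)) (minus (v (Rmax t 0)) (U0 T)).

Section Prolong.
Context {H : HilbertSpace} (T : R) (hT : 0 < T) (U0 v : R -> H).

Lemma prolong_future t : 0 <= t -> prolong T U0 v t = v t.
Proof.
  intros ht. unfold prolong.
  rewrite Rmin_left, !Rmax_left by lra. apply (plus_minus_l (G := H)).
Qed.

Lemma prolong_past t : v 0 = U0 T -> t <= 0 ->
  prolong T U0 v t = U0 (Rmax (t + T) 0).
Proof.
  intros h0 ht. unfold prolong.
  rewrite Rmin_right, (Rmax_right t) by lra. rewrite h0, minus_eq_zero.
  apply (plus_zero_r (G := H)).
Qed.

Lemma prolong_continuous :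
  continuous_on (fun t => 0 <= t <= T) U0 ->
  (forall t, continuous (fun t => v (Rmax t 0)) t) ->
  forall t, continuous (prolong T U0 v) t.
Proof.
  intros hU0 hv t.
  apply (continuous_plus (V := H) (fun t => U0 (Rmax (Rmin T (t + T)) 0))
           (fun t => minus (v (Rmax t 0)) (U0 T))).
  - apply (continuous_on_comp _ U0 (fun t => Rmax (Rmin T (t + T)) 0) t hU0).
    + intros s. unfold Rmax, Rmin.
      destruct (Rle_dec T (s + T)); destruct Rle_dec; lra.
    + apply (continuous_Rmax_const (fun t => Rmin T (t + T))).
      apply (continuous_ext (fun t => - Rmax (- (t + T)) (- T))).
      { intros s. rewrite <- Ropp_Rmin, Ropp_involutive. apply Rmin_comm. }
      apply (continuous_opp (V := R_NormedModule) (fun t => Rmax (- (t + T)) (- T))).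
      apply (continuous_Rmax_const (fun t => - (t + T))).
      apply (ex_derive_continuous (V := R_NormedModule)). auto_derive. trivial.
  - apply (continuous_minus (V := H) (fun t => v (Rmax t 0)) (fun _ => U0 T)).
    + apply hv.
    + apply continuous_const.
Qed.

End Prolong.

Lemma prolong_agree_past {H : HilbertSpace} (T : R) (U0 v w : R -> H) t :
  v 0 = w 0 -> t <= 0 -> prolong T U0 v t = prolong T U0 w t.
Proof. intros h ht. unfold prolong. now rewrite (Rmax_right t), h. Qed.

(** * The delay equation as a fixed point problem *)

(** [L] is a Lipschitz constant of [N] in the weighted norm, [M] a bound of the
    semigroup, and [duhamel_map] gains a factor [1 / lam]; so the map is
    [M * L / lam]-Lipschitz. *)
Lemma solution_operator_contracts {H : HilbertSpace} (S : R -> H -> H)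
    (hS : C0_semigroup S) (M : R) (hM0 : 0 <= M)
    (hM : forall t x, 0 <= t -> norm (S t x) <= M * norm x)
    (T : R) (hT : 0 < T) (U0 : R -> H) (N : (R -> H) -> R -> H) (L lam : R)
    (hL : 0 <= L) (hlam : 0 < lam) (hML : 2 * (M * L) <= lam)
    (hNc : forall u, (forall s, continuous u s) -> forall s, continuous (N u) s)
    (hN : forall u v C r,
       (forall s, s <= r -> norm (minus (u s) (v s)) <= C * exp (lam * s)) ->
       forall s, s <= r -> norm (minus (N u s) (N v s)) <= L * (C * exp (lam * s))) :
  causal_half_contraction lam (fun u => prolong T U0 (duhamel_map S (U0 T) (N u))).
Proof.
  intros u v C r hu hv h s hs.
  assert (he := exp_pos (lam * s)).
  assert (hC : 0 <= C).
  { assert (h1 := Rle_trans _ _ _ (norm_ge_0 (V := H) _) (h s hs)).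
    apply Rmult_le_reg_r with (1 := he). lra. }
  destruct (Rle_lt_dec s 0) as [hs0|hs0].
  - rewrite (prolong_agree_past T U0 _ (duhamel_map S (U0 T) (N v))), norm_minus_self;
      [| now rewrite !duhamel_map_0 | exact hs0].
    apply Rmult_le_pos; lra.
  - rewrite !prolong_future by lra.
    apply Rle_trans with (M * (L * C) / lam * exp (lam * s)).
    + apply (duhamel_map_gap S hS M hM); auto; try lra.
      * now apply Rmult_le_pos.
      * intros q hq. rewrite Rmult_assoc. apply (hN u v C r h). lra.
    + apply Rmult_le_compat_r; [lra|].
      apply Rmult_le_reg_r with (1 := hlam). field_simplify; [|lra].
      assert (h1 : C * (2 * (M * L)) <= C * lam) by now apply Rmult_le_compat_l.
      lra.
Qed.

Theorem proposition2p1 (H : HilbertSpace) (A : LinearOperator H)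
  (S : R -> H -> H)
  (hS : C0_semigroup S) (hA : generates A S) (hstab : exponentially_stable S)
  (I : nat) (hI : (1 <= I)%nat)
  (tau : nat -> R)
  (htau_pos : forall i, (1 <= i <= I)%nat -> 0 < tau i)
  (htau_distinct : forall i j, (1 <= i <= I)%nat -> (1 <= j <= I)%nat ->
     i <> j -> tau i <> tau j)
  (htau_max : forall i, (2 <= i <= I)%nat -> tau i < tau 1%nat)
  (F : nat -> H -> H -> H)
  (hF : forall i, (1 <= i <= I)%nat -> exists gamma : R, 0 < gamma /\
     forall U1 U2 V1 V2 : H,
       norm (minus (F i U1 U2) (F i V1 V2)) <=
         gamma * (norm (minus U1 V1) + norm (minus U2 V2))) :
  forall U0 : R -> H,
    continuous_on (fun t => 0 <= t <= tau 1%nat) U0 ->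
    exists U : R -> H,
      delay_mild_solution S I tau F U0 U /\
      (forall V : R -> H, delay_mild_solution S I tau F U0 V ->
         forall t, 0 <= t -> V t = U t) /\
      (forall t, 0 <= t ->
         duhamel S (U0 (tau 1%nat)) (delay_term I tau F U) U t).
Proof.
  intros U0 hU0.
  destruct (semigroup_bounded S hS hstab) as [M [hM0 hM]].
  destruct (delay_term_lipschitz tau F I hF) as [L [hL hLip]].
  assert (hT : 0 < tau 1%nat) by (apply htau_pos; lia).
  assert (hle : forall i, (1 <= i <= I)%nat -> tau i <= tau 1%nat).
  { intros i hi. destruct (Nat.eq_dec i 1) as [->|hne]; [lra|].
    apply Rlt_le, htau_max. lia. }
  set (T := tau 1%nat) in *.
  assert (hML : 0 <= M * L) by (apply Rmult_le_pos; lra).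
  set (lam := 2 * (M * L) + 1).
  assert (hlam : 0 < lam) by (unfold lam; lra).
  set (N := delay_term I tau F).
  assert (hNc : forall u, (forall s, continuous u s) -> forall s, continuous (N u) s).
  { now apply delay_term_continuous. }
  set (E := fun u => prolong T U0 (duhamel_map S (U0 T) (N u))).
  assert (Econt : forall u, (forall s, continuous u s) -> forall s, continuous (E u) s).
  { intros u hu. apply prolong_continuous; [exact hT | exact hU0 |].
    apply (duhamel_map_continuous S hS M hM). now apply hNc. }
  assert (Econtr : causal_half_contraction lam E).
  { apply (solution_operator_contracts S hS M (Rlt_le _ _ hM0) hM T hT U0 N L lam);
      auto; [unfold lam; lra|].
    intros u v C r h s hs. apply hLip; [now apply h|].
    (* Since the weight increases, looking back in time only helps. *)
    intros i hi. assert (hti := htau_pos i hi).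
    apply Rle_trans with (1 := h (s - tau i) ltac:(lra)).
    assert (hC : 0 <= C).
    { assert (h1 := Rle_trans _ _ _ (norm_ge_0 (V := H) _) (h s hs)).
      apply Rmult_le_reg_r with (1 := exp_pos (lam * s)). lra. }
    apply Rmult_le_compat_l; [exact hC|]. apply Rlt_le, exp_increasing.
    apply Rmult_lt_compat_l; lra. }
  assert (Ehist : forall u v t, t <= 0 -> E u t = E v t).
  { intros u v t ht. apply prolong_agree_past; [|exact ht].
    now rewrite !(duhamel_map_0 S hS). }
  destruct (causal_fixed_point_exists lam E Econt Econtr Ehist) as [U [hUc hUfix]].
  assert (hU0T : U 0 = U0 T).
  { rewrite <- hUfix. unfold E. rewrite prolong_future by lra.
    apply (duhamel_map_0 S hS). }
  assert (hduh : forall t, 0 <= t -> duhamel S (U0 T) (N U) U t).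
  { intros t ht. split.
    - apply (ex_RInt_duhamel S hS M hM (N U)); auto.
    - rewrite <- (hUfix t) at 1. unfold E. now rewrite prolong_future. }
  exists U. split; [|split; [|exact hduh]].
  - split; [split|].
    + apply continuous_on_forall. intros t _. apply hUc.
    + intros t ht. rewrite hU0T. now apply hduh.
    + intros t ht. fold T in ht |- *. rewrite <- hUfix. unfold E.
      rewrite prolong_past; [| apply (duhamel_map_0 S hS) | lra].
      f_equal. rewrite Rmax_left by lra. ring.
  - intros V [[hVc hVd] hVh] t ht. fold T in hVh.
    assert (hV0 : V 0 = U0 T).
    { rewrite <- hVh by lra. f_equal. ring. }
    (* The values of [V] up to [-T] are arbitrary: they are replaced by
       continuous ones, which the Duhamel integral over the open interval does
       not see, as [s - tau i > -T] for [s > 0]. *)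
    set (W := prolong T U0 V).
    assert (hWfut : forall s, 0 <= s -> W s = V s).
    { intros s hs. now apply prolong_future. }
    assert (hWpast : forall s, - T < s -> W s = V s).
    { intros s hs. destruct (Rle_lt_dec s 0) as [hs0|hs0]; [|apply hWfut; lra].
      unfold W. rewrite prolong_past by auto. rewrite Rmax_left by lra.
      rewrite <- hVh by lra. f_equal. ring. }
    assert (hWc : forall s, continuous W s).
    { apply prolong_continuous; [exact hT | exact hU0 |]. intros s.
      apply (continuous_on_comp _ V (fun s => Rmax s 0) s hVc).
      - intros q. apply Rmax_r.
      - apply (continuous_Rmax_const (fun s : R => s)), continuous_id. }
    assert (hVE : forall s, 0 <= s -> V s = duhamel_map S (U0 T) (N W) s).
    { intros s hs. rewrite (proj2 (hVd s hs)), hV0.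
      change (duhamel_map S (U0 T) (N V) s = duhamel_map S (U0 T) (N W) s).
      apply duhamel_map_agree; [exact hs|]. intros r hr.
      apply delay_term_agree; [symmetry; apply hWfut; lra|].
      intros i hi. symmetry. apply hWpast. assert (h := hle i hi). lra. }
    rewrite <- hWfut by exact ht.
    apply (causal_fixed_point_unique lam E Econtr Ehist W U hWc hUc); [|exact hUfix].
    intros s. unfold E, W. unfold prolong at 1 3.
    rewrite (hVE (Rmax s 0)) by apply Rmax_r. reflexivity.
Qed.
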